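(* Let $f:\mathbb R^n\to\mathbb R$ be convex and submodular, let $\bm a\in\mathbb R^n$, and let $\bm\ell\in(\mathbb R\cup\{-\infty\})^n$, $\bm u\in(\mathbb R\cup\{+\infty\})^n$ with $\bm\ell\le\bm u$. Let $\mathcal N_+=\{i\in[n]:0\le\ell_i\le u_i\}$, $\mathcal N_-=\{i\in[n]:\ell_i\le u_i\le 0\}$, $\mathcal N_\pm=\{i\in[n]:\ell_i<0<u_i\}$. Let $v_\pm(\bm z^+,\bm z^-)$ be the minimum of $f(\bm x)-\bm a^\top\bm x$ over $\bm x$ subject to $$\begin{aligned}&\ell_iz_i^+\le x_i\le u_iz_i^+ && \forall i\in\mathcal N_+,\\ &\ell_i(1-z_i^-)\le x_i\le u_i(1-z_i^-)&&\forall i\in\mathcal N_-,\\ &\ell_i(1-z_i^-)\le x_i\le u_iz_i^+,\quad z_i^-\ge z_i^+&&\forall i\in\mathcal N_\pm,\\ &\bm x\in\mathbb R^n,\ \bm z^+\in\{0,1\}^{\mathcal N_+\cup\mathcal N_\pm},\ \bm z^-\in\{0,1\}^{\mathcal N_-\cup\mathcal N_\pm}.\end{aligned}$$ Then the function $v_\pm$ is submodular on $\{0,1\}^{\mathcal N_+\cup\mathcal N_\pm}\times\{0,1\}^{\mathcal N_-\cup\mathcal N_\pm}$.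
   Context: $[n]=\{1,\dots,n\}$. Convention: $0\cdot(\pm\infty)=0$. $\wedge$ and $\vee$ denote componentwise minimum and maximum of vectors; a set is a lattice if it is closed under $\wedge$ and $\vee$. A function $g$ is submodular on a lattice $\mathcal L$ if $g(\bm y^1)+g(\bm y^2)\ge g(\bm y^1\wedge\bm y^2)+g(\bm y^1\vee\bm y^2)$ for all $\bm y^1,\bm y^2\in\mathcal L$; ''$f:\mathbb R^n\to\mathbb R$ submodular'' means submodular on $\mathbb R^n$. *)

(* Defs.v *)
From HB Require Import structures.
From mathcomp Require Import all_boot all_order all_algebra.
From mathcomp Require Import all_classical all_reals all_analysis.

Set Implicit Arguments.
Unset Strict Implicit.
Unset Printing Implicit Defensive.

Import Order.TTheory GRing.Theory Num.Theory.

Local Open Scope classical_set_scope.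
Local Open Scope ring_scope.

(* The library orders function spaces pointwise, so on ['I_n -> R] and on
   [I -> bool] the operations [Order.meet] and [Order.join] are the
   componentwise minimum and maximum; [A *p B] carries the product order.

   Sums use the dual addition of extended reals, for which [+oo] absorbs [-oo]:
   this is the usual convention for minimization problems, where [+oo] stands
   for infeasibility. It only matters if one side mixes [+oo] and [-oo]. *)
Definition submodular (R : realType) (d : Order.disp_t) (L : latticeType d)
    (g : L -> \bar R) : Prop :=
  forall y1 y2 : L,
    (dual_adde (g (Order.meet y1 y2)) (g (Order.join y1 y2)) <=
     dual_adde (g y1) (g y2))%E.

Section Problem.
Variables (R : realType) (n : nat).
Variables (l u : 'I_n -> \bar R).

Definition Nplus : {set 'I_n} := [set i | (0 <= l i)%E && (l i <= u i)%E].

Definition Nminus : {set 'I_n} := [set i | (l i <= u i)%E && (u i <= 0)%E].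

Definition Npm : {set 'I_n} := [set i | (l i < 0)%E && (0 < u i)%E].

Definition Iplus := {i : 'I_n | i \in Nplus :|: Npm}.

Definition Iminus := {i : 'I_n | i \in Nminus :|: Npm}.

Definition plus_Iplus i (iP : i \in Nplus) : Iplus :=
  exist _ i (fintype.subsetP (finset.subsetUl Nplus Npm) i iP).

Definition pm_Iplus i (iP : i \in Npm) : Iplus :=
  exist _ i (fintype.subsetP (finset.subsetUr Nplus Npm) i iP).

Definition minus_Iminus i (iP : i \in Nminus) : Iminus :=
  exist _ i (fintype.subsetP (finset.subsetUl Nminus Npm) i iP).

Definition pm_Iminus i (iP : i \in Npm) : Iminus :=
  exist _ i (fintype.subsetP (finset.subsetUr Nminus Npm) i iP).

Definition indicators := ((Iplus -> bool) *p (Iminus -> bool))%type.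

Definition ind (b : bool) : R := b%:R.

(* The product of extended reals satisfies [0 * +oo = 0 * -oo = 0]. *)
Definition feasible (z : indicators) (x : 'I_n -> R) : Prop :=
  let zp := z.1 in let zm := z.2 in
  [/\ forall i (iP : i \in Nplus), let p := ind (zp (plus_Iplus iP)) in
        (l i * p%:E <= (x i)%:E <= u i * p%:E)%E,
      forall i (iP : i \in Nminus), let m := ind (zm (minus_Iminus iP)) in
        (l i * (1 - m)%:E <= (x i)%:E <= u i * (1 - m)%:E)%E
    & forall i (iP : i \in Npm),
        let p := ind (zp (pm_Iplus iP)) in
        let m := ind (zm (pm_Iminus iP)) in
        (l i * (1 - m)%:E <= (x i)%:E <= u i * p%:E)%E /\ p <= m].

(* The value is the infimum, hence the minimum whenever it is attained; it is
   [+oo] if no [x] is feasible and [-oo] if the problem is unbounded. *)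
Definition vpm (f : ('I_n -> R) -> R) (a : 'I_n -> R) (z : indicators) :
    \bar R :=
  ereal_inf [set (f x - \sum_i a i * x i)%:E | x in feasible z].

End Problem.

Arguments vpm {R n} l u f a z.

(* Main.v *)
Require Import Defs.
From HB Require Import structures.
From mathcomp Require Import all_boot all_order all_algebra.
From mathcomp Require Import all_classical all_reals all_analysis.

Set Implicit Arguments.
Unset Strict Implicit.
Unset Printing Implicit Defensive.

Import Order.TTheory GRing.Theory Num.Theory.
Import DualAddTheory.

Local Open Scope classical_set_scope.
Local Open Scope ring_scope.

(* The pairs (z, x) with x feasible for z form a lattice: every constraint
   bounds x_i, from below or above, by a nondecreasing function of one binary
   variable, or compares two binary variables. The objective is submodular on
   this lattice, and minimizing out x preserves submodularity. *)

(** Since [T] is totally ordered, one may take [y1 <= y2]. By monotonicity [lo y1] then lies below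
    both [x1] and [x2], while [lo y2] lies below [x2] and hence below the join. *)
Lemma homo_le_meet_join (d d' : Order.disp_t) (T : orderType d)
    (L : latticeType d') (lo : T -> L) (y1 y2 : T) (x1 x2 : L) :
  {homo lo : y y' / (y <= y')%O} -> (lo y1 <= x1)%O -> (lo y2 <= x2)%O ->
  (lo (y1 `&` y2) <= x1 `&` x2)%O /\ (lo (y1 `|` y2) <= x1 `|` x2)%O.
Proof.
move=> lo_homo lx1 lx2.
wlog le_y : y1 y2 x1 x2 lx1 lx2 / (y1 <= y2)%O => [wlg|].
  have /orP[le_y|le_y] := le_total y1 y2; first exact: wlg.
  rewrite (meetC x1) (joinC x1) (meetC y1) (joinC y1); exact: wlg.
rewrite (meet_l le_y) (join_r le_y) lexI lx1 (lexUr _ lx2).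
by rewrite (le_trans (lo_homo _ _ le_y) lx2).
Qed.

Lemma homo_ge_meet_join (d d' : Order.disp_t) (T : orderType d)
    (L : latticeType d') (hi : T -> L) (y1 y2 : T) (x1 x2 : L) :
  {homo hi : y y' / (y <= y')%O} -> (x1 <= hi y1)%O -> (x2 <= hi y2)%O ->
  (x1 `&` x2 <= hi (y1 `&` y2))%O /\ (x1 `|` x2 <= hi (y1 `|` y2))%O.
Proof.
move=> hi_homo xh1 xh2.
(* In the dual orders upper bounds become lower bounds and meet and join trade places. *)
have hi_homod : {homo hi : y y' / (y <= y' :> T^d)%O >-> (y <= y' :> L^d)%O}.
  by move=> y y'; exact: hi_homo.
by have [] := @homo_le_meet_join _ _ T^d L^d hi y1 y2 x1 x2 hi_homod xh1 xh2.
Qed.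

(** The two bounds take separate arguments because on [Npm] the lower one is driven by $z^-_i$ and
    the upper one by $z^+_i$. *)
Lemma itv_meet_join (d1 d2 d' : Order.disp_t) (T1 : orderType d1)
    (T2 : orderType d2) (L : latticeType d') (lo : T1 -> L) (hi : T2 -> L)
    (p1 p2 : T1) (q1 q2 : T2) (x1 x2 : L) :
  {homo lo : y y' / (y <= y')%O} -> {homo hi : y y' / (y <= y')%O} ->
  (lo p1 <= x1 <= hi q1)%O -> (lo p2 <= x2 <= hi q2)%O ->
  (lo (p1 `&` p2) <= x1 `&` x2 <= hi (q1 `&` q2))%O /\
  (lo (p1 `|` p2) <= x1 `|` x2 <= hi (q1 `|` q2))%O.
Proof.
move=> lo_homo hi_homo /andP[lx1 xh1] /andP[lx2 xh2].
have [-> ->] := homo_le_meet_join lo_homo lx1 lx2.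
by have [-> ->] := homo_ge_meet_join hi_homo xh1 xh2.
Qed.

Lemma le_dual_add_ereal_inf (R : realType) (A B : set R) (c : \bar R) :
  (forall a b, A a -> B b -> (c <= (a + b)%:E)%E) ->
  (c <= (ereal_inf (EFin @` A) + ereal_inf (EFin @` B))%dE)%E.
Proof.
move=> le_c.
(* The infima are taken one at a time: a finite [a] can be moved across, so that [c - a] is a lower
   bound of [B]. *)
have step a : A a -> (c <= (a%:E + ereal_inf (EFin @` B))%dE)%E.
  move=> Aa; rewrite -lee_dsubl_addl//; apply/ereal_infP => _ [b Bb <-].
  by rewrite lee_dsubl_addl//; exact: le_c.
case: (ereal_inf (EFin @` B)) step => [r| |] step.
- rewrite -lee_dsubl_addr//; apply/ereal_infP => _ [a Aa <-].
  by rewrite lee_dsubl_addr//; exact: step.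
- by rewrite daddey leey.
(* Here the infimum over [B] is [-oo]. A point of [A] forces [c] down to [-oo]; if [A] is empty, its
   infimum [+oo] absorbs [-oo] in the dual sum. *)
- have [[a Aa]|A0] := pselect (exists a, A a).
    by rewrite (le_trans (step a Aa))//= leNye.
  suff -> : A = set0 by rewrite image_set0 ereal_inf0 leey.
  by rewrite -subset0 => a Aa; apply: A0; exists a.
Qed.

(** The meet and join of points feasible for [y1] and [y2] are candidates in the infima at the meet
    and join of [y1] and [y2], and submodularity of [g] compares the values. *)
Lemma submodular_ereal_inf (R : realType) (d d' : Order.disp_t)
    (L : latticeType d) (X : latticeType d') (F : L -> X -> Prop) (g : X -> R) :
  (forall y1 y2 x1 x2, F y1 x1 -> F y2 x2 ->
    F (y1 `&` y2)%O (x1 `&` x2)%O /\ F (y1 `|` y2)%O (x1 `|` x2)%O) ->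
  submodular (fun x => (g x)%:E) ->
  submodular (fun y => ereal_inf [set (g x)%:E | x in F y]).
Proof.
move=> F_lattice g_submod y1 y2.
have imE y : [set (g x)%:E | x in F y] = EFin @` (g @` F y).
  by rewrite image_comp.
rewrite (imE y1) (imE y2).
apply: le_dual_add_ereal_inf => _ _ [x1 Fx1 <-] [x2 Fx2 <-].
have [Fmeet Fjoin] := F_lattice _ _ _ _ Fx1 Fx2.
apply: le_trans (g_submod x1 x2).
have inf_le y x : F y x -> (ereal_inf [set (g x)%:E | x in F y] <= (g x)%:E)%E.
  by move=> Fx; apply: ereal_inf_lbound; exists x.
exact: (lee_dD (inf_le _ _ Fmeet) (inf_le _ _ Fjoin)).
Qed.

Section Feasible.
Variables (R : realType) (n : nat) (l u : 'I_n -> \bar R).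

Let scale_homo (e : \bar R) : (0 <= e)%E ->
  {homo (fun b : bool => e * (ind R b)%:E)%E : b b' / (b <= b')%O}.
Proof.
by move=> e0 [] []//= _; rewrite /ind !(mule0, mule1).
Qed.

(** Complementing [b] and multiplying by [e <= 0] each reverse the order. An infinite [e] is covered
    by the convention that its product with 0 is 0. *)
Let scaleC_homo (e : \bar R) : (e <= 0)%E ->
  {homo (fun b : bool => e * (1 - ind R b)%:E)%E : b b' / (b <= b')%O}.
Proof.
by move=> e0 [] []//= _; rewrite /ind ?subrr ?subr0 !(mule0, mule1).
Qed.

Let EFin_meet (x y : R) : (x `&` y)%O%:E = (x%:E `&` y%:E)%O.
Proof. by rewrite !meetEtotal EFin_min. Qed.

Let EFin_join (x y : R) : (x `|` y)%O%:E = (x%:E `|` y%:E)%O.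
Proof. by rewrite !joinEtotal EFin_max. Qed.

Let Nplus_ge0 i : i \in Nplus l u -> (0 <= l i /\ 0 <= u i)%E.
Proof. by rewrite inE => /andP[l0 /(le_trans l0)]. Qed.

Let Nminus_le0 i : i \in Nminus l u -> (l i <= 0 /\ u i <= 0)%E.
Proof. by rewrite inE => /andP[le_lu u0]; rewrite (le_trans le_lu). Qed.

Let Npm_sign i : i \in Npm l u -> (l i <= 0 /\ 0 <= u i)%E.
Proof. by rewrite inE => /andP[/ltW ? /ltW]. Qed.

Let ind_le (b b' : bool) : (ind R b <= ind R b') = (b <= b')%O.
Proof. by rewrite /ind ler_nat. Qed.

Lemma feasible_meet_join (z1 z2 : indicators l u) (x1 x2 : 'I_n -> R) :
  feasible z1 x1 -> feasible z2 x2 ->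
  feasible (z1 `&` z2)%O (x1 `&` x2)%O /\ feasible (z1 `|` z2)%O (x1 `|` x2)%O.
Proof.
move=> [P1 M1 PM1] [P2 M2 PM2].
(* On each index class the signs of [l i] and [u i] are those that make both bounds nondecreasing in
   their binary variable. *)
have P i iP := let: conj l0 u0 := Nplus_ge0 iP in
  itv_meet_join (scale_homo l0) (scale_homo u0) (P1 i iP) (P2 i iP).
have M i iM := let: conj l0 u0 := Nminus_le0 iM in
  itv_meet_join (scaleC_homo l0) (scaleC_homo u0) (M1 i iM) (M2 i iM).
have PM i iPM := let: conj l0 u0 := Npm_sign iPM in
  itv_meet_join (scaleC_homo l0) (scale_homo u0)
    (PM1 i iPM).1 (PM2 i iPM).1.
rewrite meetEprod joinEprod; split; split=> i iN /=;
  rewrite ?meetfE ?joinfE ?EFin_meet ?EFin_join.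
- exact: (P i iN).1.
- exact: (M i iN).1.
- split; first exact: (PM i iN).1.
  have := (PM1 i iN).2; have := (PM2 i iN).2; rewrite !ind_le => le2 le1.
  exact: leI2.
- exact: (P i iN).2.
- exact: (M i iN).2.
- split; first exact: (PM i iN).2.
  have := (PM1 i iN).2; have := (PM2 i iN).2; rewrite !ind_le => le2 le1.
  exact: leU2.
Qed.

End Feasible.

(** A linear term is modular: in each coordinate the minimum and the maximum add up to the sum of
    the two entries. *)
Lemma submodular_sub_linear (R : realType) (n : nat) (f : ('I_n -> R) -> R)
    (a : 'I_n -> R) :
  submodular (fun x => (f x)%:E) ->
  submodular (fun x => (f x - \sum_i a i * x i)%:E).
Proof.
move=> f_submod x1 x2.
have := f_submod x1 x2.
rewrite /= !lee_fin => le_f.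
rewrite addrACA [leRHS]addrACA -!opprD -!big_split/=.
suff -> : \sum_i (a i * (x1 `&` x2)%O i + a i * (x1 `|` x2)%O i) =
   \sum_i (a i * x1 i + a i * x2 i) by rewrite lerD2r.
apply: eq_bigr => i _; rewrite -!mulrDr meetfE joinfE meetEtotal joinEtotal.
by rewrite addr_min_max.
Qed.

Theorem theorem2 (R : realType) (n : nat)
  (f : ('I_n -> R) -> R) (a : 'I_n -> R) (l u : 'I_n -> \bar R)
  (f_convex : @convex_function R ('I_n -> R^o) setT f)
  (f_submodular : submodular (fun x : 'I_n -> R => (f x)%:E))
  (l_fin : forall i, l i != +oo%E) (u_fin : forall i, u i != -oo%E)
  (le_lu : forall i, (l i <= u i)%E) :
  submodular (vpm l u f a).
Proof.
exact: (submodular_ereal_inf (@feasible_meet_join R n l u)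
         (submodular_sub_linear a f_submodular)).
Qed.
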